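(* Let $n\ge 1$ and let $B\colon \mathbf{R}^{n+1}\times\mathbf{R}^{n+1}\to\mathbf{R}^m$ be a symmetric nonsingular bilinear map. Then the map $$\mathbf{R}^{n+1}\supset\mathbf{S}^n\ni x\longmapsto \big(x,B(x,x)\big)\in\mathbf{R}^{n+1}\times\mathbf{R}^m$$ is a totally skew embedding. In particular, $$N(\mathbf{S}^n)\le n+m(n)+1,$$ where $m(n)$ is the smallest dimension $m$ for which a symmetric nonsingular bilinear map $\mathbf{R}^{n+1}\times\mathbf{R}^{n+1}\to\mathbf{R}^m$ exists.
   Context: $\mathbf{S}^n$ is the unit sphere of $\mathbf{R}^{n+1}$. $B$ is symmetric if $B(x,y)=B(y,x)$ for all $x,y$, and nonsingular if $B(x,y)=0$ only if $x=0$ or $y=0$. A pair of lines in $\mathbf{R}^N$ is skew if they are not parallel and do not intersect (in particular, two equal lines are not skew). A submanifold $M^n\subset\mathbf{R}^N$ (with $C^1$ regularity) is totally skew if every pair of (affine) tangent lines of $M$ is skew, unless they are tangent to $M$ at the same point. A ($C^1$) embedding is totally skew if its image is a totally skew submanifold. $N(M^n)$ denotes the smallest $N$ such that the manifold $M^n$ admits a totally skew embedding in $\mathbf{R}^N$. *)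

(* Defs.v *)
From HB Require Import structures.
From mathcomp Require Import all_boot all_order all_algebra.
From mathcomp Require Import all_classical all_reals all_analysis.

Set Implicit Arguments.
Unset Strict Implicit.
Unset Printing Implicit Defensive.

Import Order.TTheory GRing.Theory Num.Theory.
Import numFieldNormedType.Exports.

Local Open Scope classical_set_scope.
Local Open Scope ring_scope.

(* R^N is 'rV[R]_N.  The library norm on it is the sup norm, which induces the
   Euclidean topology and differentials; only [unit_sphere] depends on the
   Euclidean norm itself, which is therefore written out. *)

Definition unit_sphere (R : realType) (n : nat) : set 'rV[R]_n.+1 :=
  [set x | \sum_(i < n.+1) x ord0 i ^+ 2 = 1].

(* The domains below are finite-dimensional, so pointwise continuity of the
   differential is continuity in operator norm. *)
Definition C1_on (R : realType) (V W : normedModType R) (U : set V)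
    (f : V -> W) : Prop :=
  open U /\
  forall x, U x ->
    differentiable f x /\
    forall v, {for x, continuous (fun y => 'd f y v)}.

(* Near each of its points, M is the homeomorphic image of an open subset of
   R^n under a C^1 immersion. *)
Definition C1_submanifold (R : realType) (n N : nat) (M : set 'rV[R]_N) : Prop :=
  forall p, M p ->
    exists (U : set 'rV[R]_N) (V : set 'rV[R]_n)
           (phi : 'rV[R]_n -> 'rV[R]_N) (psi : 'rV[R]_N -> 'rV[R]_n),
      [/\ open U /\ U p,
          C1_on V phi,
          forall x, V x -> injective ('d phi x),
          phi @` V = M `&` U &
          (forall x, V x -> psi (phi x) = x) /\
          {within M `&` U, continuous psi}].

Definition tangent_vector (R : realType) (N : nat) (M : set 'rV[R]_N)
    (p v : 'rV[R]_N) : Prop :=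
  exists (e : R) (c : R -> 'rV[R]_N),
    [/\ 0 < e,
        C1_on `]- e, e[%classic c,
        forall t, - e < t < e -> M (c t),
        c 0 = p &
        'd c 0 1 = v].

Definition affine_line (R : realType) (N : nat) (p v : 'rV[R]_N) :
    set 'rV[R]_N :=
  [set p + t *: v | t in [set: R]].

Definition parallel (R : realType) (N : nat) (l l' : set 'rV[R]_N) : Prop :=
  exists p q v : 'rV[R]_N,
    [/\ v != 0, l = affine_line p v & l' = affine_line q v].

Definition skew (R : realType) (N : nat) (l l' : set 'rV[R]_N) : Prop :=
  ~ parallel l l' /\ l `&` l' = set0.

Definition tangent_line (R : realType) (N : nat) (M : set 'rV[R]_N)
    (p : 'rV[R]_N) (l : set 'rV[R]_N) : Prop :=
  exists v, [/\ tangent_vector M p v, v != 0 & l = affine_line p v].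

Definition totally_skew_submanifold (R : realType) (n N : nat)
    (M : set 'rV[R]_N) : Prop :=
  C1_submanifold n M /\
  forall (p q : 'rV[R]_N) (l l' : set 'rV[R]_N),
    M p -> M q -> p <> q ->
    tangent_line M p l -> tangent_line M q l' -> skew l l'.

(* A map on a submanifold M of R^k is given by a function on R^k, of which only
   the values on M matter: it is C^1 when it extends, near each point of M, to
   a C^1 map g on an open subset of R^k.  The restriction of 'd g p to the
   tangent space of M at p does not depend on the choice of g. *)
Definition C1_immersion (R : realType) (k N : nat) (M : set 'rV[R]_k)
    (f : 'rV[R]_k -> 'rV[R]_N) : Prop :=
  forall p, M p ->
    exists (U : set 'rV[R]_k) (g : 'rV[R]_k -> 'rV[R]_N),
      [/\ U p,
          C1_on U g,
          forall x, M x -> U x -> g x = f x &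
          forall v, tangent_vector M p v -> 'd g p v = 0 -> v = 0].

Definition C1_embedding (R : realType) (k N : nat) (M : set 'rV[R]_k)
    (f : 'rV[R]_k -> 'rV[R]_N) : Prop :=
  [/\ C1_immersion M f,
      {within M, continuous f} &
      exists g : 'rV[R]_N -> 'rV[R]_k,
        (forall x, M x -> g (f x) = x) /\
        {within f @` M, continuous g}].

Definition totally_skew_embedding (R : realType) (n k N : nat)
    (M : set 'rV[R]_k) (f : 'rV[R]_k -> 'rV[R]_N) : Prop :=
  C1_embedding M f /\ totally_skew_submanifold n (f @` M).

Definition symmetric_bilinear (R : realType) (d m : nat)
    (B : {bilinear 'rV[R]_d -> 'rV[R]_d -> 'rV[R]_m}) : Prop :=
  forall x y, B x y = B y x.

Definition nonsingular_bilinear (R : realType) (d m : nat)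
    (B : {bilinear 'rV[R]_d -> 'rV[R]_d -> 'rV[R]_m}) : Prop :=
  forall x y, B x y = 0 -> x = 0 \/ y = 0.

Definition is_smallest (P : nat -> Prop) (k : nat) : Prop :=
  P k /\ forall j, P j -> (k <= j)%N.

(* N(M) = N, for an n-dimensional submanifold M of R^k *)
Definition is_totally_skew_dim (R : realType) (n k : nat) (M : set 'rV[R]_k) :
    nat -> Prop :=
  is_smallest (fun N => exists f : 'rV[R]_k -> 'rV[R]_N,
                 totally_skew_embedding n M f).

(* m(n) = m *)
Definition is_symmetric_nonsingular_dim (R : realType) (n : nat) :
    nat -> Prop :=
  is_smallest (fun m =>
    exists B : {bilinear 'rV[R]_n.+1 -> 'rV[R]_n.+1 -> 'rV[R]_m},
      symmetric_bilinear B /\ nonsingular_bilinear B).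

(* Main.v *)
(* A tangent vector of the graph of x |-> B(x, x) over the sphere at the point
   over x is (u, 2 B(x, u)) with u orthogonal to x.  If the tangent lines at
   x and y along u and v are parallel, then v is proportional to u and
   B(x - y, u) = 0.  If they meet, x + t u = y + s v, then completing the
   square in the second component gives B(tu, tu) = B(sv, sv), hence
   B(tu - sv, tu + sv) = 0 and t u = s v or t u = - s v.  The first case gives
   x = y, and so does the second because y = x + 2 t u lies on the sphere while
   u is orthogonal to x. *)

Require Import Defs.
From HB Require Import structures.
From mathcomp Require Import all_boot all_order all_algebra.
From mathcomp Require Import all_classical all_reals all_analysis.
From mathcomp Require Import ring.
Set Implicit Arguments.
Unset Strict Implicit.
Unset Printing Implicit Defensive.

Import Order.TTheory GRing.Theory Num.Theory.
Import numFieldNormedType.Exports.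
Local Open Scope classical_set_scope.
Local Open Scope ring_scope.

(** * Continuity and differentials of linear and bilinear maps *)

Lemma continuous_sum (R : realType) (T : topologicalType)
    (W : normedModType R) (I : Type) (r : seq I) (F : I -> T -> W) (x : T) :
  (forall i, {for x, continuous (F i)}) ->
  {for x, continuous (fun y => \sum_(i <- r) F i y)}.
Proof.
move=> cF; apply: cvg_big => [|i _]; last exact: cF.
exact: add_continuous.
Qed.

(** Expansion in elementary matrices turns [L] into a finite sum of entries times fixed vectors. *)
Lemma linear_mx_continuous (R : realType) (m n : nat) (W : normedModType R)
    (L : {linear 'M[R]_(m, n) -> W}) : continuous L.
Proof.
move=> x.
have -> : L = (fun y : 'M[R]_(m, n) =>
    \sum_i \sum_j y i j *: L (delta_mx i j)) :> (_ -> _).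
  apply/funext => y; rewrite {1}(matrix_sum_delta y) linear_sum.
  apply: eq_bigr => i _; rewrite linear_sum; apply: eq_bigr => j _.
  by rewrite linearZ.
apply: continuous_sum => i; apply: continuous_sum => j.
by apply: continuousZr_tmp; apply: coord_continuous.
Qed.

(** Only the first argument is expanded in the standard basis; each [B (delta_mx ord0 i)] is linear,
    hence continuous. *)
Lemma bilinear_rV_continuous (R : realType) (k l : nat) (W : normedModType R)
    (B : {bilinear 'rV[R]_k -> 'rV[R]_l -> W}) :
  continuous (fun p : 'rV[R]_k * 'rV[R]_l => B p.1 p.2).
Proof.
move=> p.
have -> : (fun p : 'rV[R]_k * 'rV[R]_l => B p.1 p.2) = (fun p =>
    \sum_i p.1 ord0 i *: B (delta_mx ord0 i) p.2).
  apply/funext => q; rewrite {1}(row_sum_delta q.1) linear_sumlz.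
  by apply: eq_bigr => i _; rewrite linearZl_LR.
apply: continuous_sum => i; apply: continuousZ.
  apply: (@continuous_comp _ _ _ fst (fun u : 'rV[R]_k => u ord0 i)).
    exact: cvg_fst.
  exact: coord_continuous.
apply: (@continuous_comp _ _ _ snd (B (delta_mx ord0 i))).
  exact: cvg_snd.
exact: linear_mx_continuous.
Qed.

Lemma diff_linear_comp (R : realType) (V W W' : normedModType R)
    (L : {linear W -> W'}) (f : V -> W) (x : V) :
  continuous L -> differentiable f x ->
  differentiable (fun y => L (f y)) x /\
  forall v, 'd (fun y => L (f y)) x v = L ('d f x v).
Proof.
move=> cL df; have dL := @linear_differentiable _ _ _ L (f x) cL.
split; first exact: (differentiable_comp df dL).
by move=> v; rewrite (diff_comp df dL) /= (diff_lin _ cL).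
Qed.

(** Leibniz rule: chain rule for the pair [(f, g)] followed by [b]. *)
Lemma diff_bilinear_comp (R : realType) (V U U' W : normedModType R)
    (b : {bilinear U -> U' -> W}) (f : V -> U) (g : V -> U') (x : V) :
  continuous (fun p => b p.1 p.2) ->
  differentiable f x -> differentiable g x ->
  differentiable (fun y => b (f y) (g y)) x /\
  forall v, 'd (fun y => b (f y) (g y)) x v =
            b (f x) ('d g x v) + b ('d f x v) (g x).
Proof.
move=> cb df dg; have dfg := differentiable_pair df dg.
have db := @differentiable_bilin _ _ _ _ b (f x, g x) cb.
split; first exact: (differentiable_comp dfg db).
move=> v; rewrite (diff_comp dfg db) /= diff_bilin //.
by rewrite diff_pair.
Qed.

Lemma continuous_bilinear_comp (R : realType) (T : topologicalType)
    (U U' W : normedModType R)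
    (b : {bilinear U -> U' -> W}) (f : T -> U) (g : T -> U') (x : T) :
  continuous (fun p => b p.1 p.2) ->
  {for x, continuous f} -> {for x, continuous g} ->
  {for x, continuous (fun y => b (f y) (g y))}.
Proof.
move=> cb cf cg; apply: (@continuous2_cvg _ _ _ _ _ _ f g b) => //.
exact: (cb (f x, g x)).
Qed.

(** * Closure properties of $C^1$ maps defined on a whole normed space *)

Section C1.
Variables (R : realType) (V : normedModType R).

Lemma C1_differentiable (W : normedModType R) (f : V -> W) (x : V) :
  C1_on setT f -> differentiable f x.
Proof. by move=> [_ /(_ x I)[]]. Qed.

Lemma C1_continuous (W : normedModType R) (f : V -> W) :
  C1_on setT f -> continuous f.
Proof. by move=> cf x; apply/differentiable_continuous/C1_differentiable. Qed.

Lemma C1_diff_continuous (W : normedModType R) (f : V -> W) (v : V) :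
  C1_on setT f -> continuous (fun y => 'd f y v).
Proof. by move=> [_ cf] x; have [_] := cf x I; exact. Qed.

(** Criterion used below: an explicit formula [D] for the differential, whose continuity is checked
    direction by direction. *)
Lemma C1I (W : normedModType R) (f : V -> W) (D : V -> V -> W) :
  (forall x, differentiable f x) -> (forall x v, 'd f x v = D x v) ->
  (forall v, continuous (fun y => D y v)) -> C1_on setT f.
Proof.
move=> df dD cD; split; first exact: openT.
move=> x _; split=> // v.
rewrite (_ : (fun y => 'd f y v) = (fun y => D y v)); first exact: cD.
by apply/funext => y; exact: dD.
Qed.

Lemma C1_cst (W : normedModType R) (a : W) : C1_on setT (fun _ : V => a).
Proof.
apply: (@C1I _ _ (fun _ _ => 0)) => [x|x v|v x].
- exact: differentiable_cst.
- by rewrite diff_cst.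
- exact: cst_continuous.
Qed.

Lemma C1D (W : normedModType R) (f g : V -> W) :
  C1_on setT f -> C1_on setT g -> C1_on setT (fun x => f x + g x).
Proof.
move=> cf cg; have df x := C1_differentiable x cf.
have dg x := C1_differentiable x cg.
apply: (@C1I _ _ (fun x v => 'd f x v + 'd g x v)) => [x|x v|v x].
- exact: differentiableD.
- by rewrite (diffD (df x) (dg x)).
- by apply: (@continuousD _ _ _ (fun x => 'd f x v) (fun x => 'd g x v));
    exact: C1_diff_continuous.
Qed.

Lemma C1_sum (W : normedModType R) (I : Type) (r : seq I) (F : I -> V -> W) :
  (forall i, C1_on setT (F i)) -> C1_on setT (fun x => \sum_(i <- r) F i x).
Proof.
move=> cF; elim: r => [|i r IHr].
  under eq_fun do rewrite big_nil; exact: C1_cst.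
rewrite (_ : (fun x => _) = fun x => F i x + \sum_(j <- r) F j x).
  exact: C1D.
by apply/funext => x; rewrite big_cons.
Qed.

Lemma C1_linear_comp (W W' : normedModType R) (L : {linear W -> W'})
    (f : V -> W) :
  continuous L -> C1_on setT f -> C1_on setT (fun x => L (f x)).
Proof.
move=> cL cf; have df x := C1_differentiable x cf.
apply: (@C1I _ _ (fun x v => L ('d f x v))) => [x|x v|v x].
- by case: (diff_linear_comp cL (df x)).
- by case: (diff_linear_comp cL (df x)).
- apply: (@continuous_comp _ _ _ (fun y => 'd f y v) L); last exact: cL.
  exact: C1_diff_continuous.
Qed.

Lemma C1_bilinear_comp (U U' W : normedModType R)
    (b : {bilinear U -> U' -> W}) (f : V -> U) (g : V -> U') :
  continuous (fun p => b p.1 p.2) -> C1_on setT f -> C1_on setT g ->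
  C1_on setT (fun x => b (f x) (g x)).
Proof.
move=> cb cf cg; have df x := C1_differentiable x cf.
have dg x := C1_differentiable x cg.
apply: (@C1I _ _ (fun x v => b (f x) ('d g x v) + b ('d f x v) (g x)))
    => [x|x v|v x].
- by case: (diff_bilinear_comp cb (df x) (dg x)).
- by case: (diff_bilinear_comp cb (df x) (dg x)).
- apply: (@continuousD _ _ _ (fun x => b (f x) ('d g x v))
      (fun x => b ('d f x v) (g x))); apply: continuous_bilinear_comp => //.
  + exact: C1_continuous.
  + exact: C1_diff_continuous.
  + exact: C1_diff_continuous.
  + exact: C1_continuous.
Qed.

Lemma C1M (f g : V -> R) :
  C1_on setT f -> C1_on setT g -> C1_on setT (fun x => f x * g x).
Proof.
by apply: (@C1_bilinear_comp _ _ _ *%R) => p; exact: mul_continuous.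
Qed.

Lemma C1V (f : V -> R) :
  (forall x, f x != 0) -> C1_on setT f -> C1_on setT (fun x => (f x)^-1).
Proof.
move=> f0 cf; have df x := C1_differentiable x cf.
apply: (@C1I _ _ (fun x v => - (f x)^-1 * (f x)^-1 * 'd f x v)) => [x|x v|v x].
- exact: differentiableV.
- by rewrite (diffV (df x) (f0 x)) /= expr2 invfM mulNr.
- apply: (@continuousM _ _ (fun x => - (f x)^-1 * (f x)^-1)); last first.
    exact: C1_diff_continuous.
  have cV : {for x, continuous (fun x => (f x)^-1)}.
    by apply: continuousV => //; exact: C1_continuous.
  by apply: (@continuousM _ _ (fun x => - (f x)^-1)) => //; exact: continuousN.
Qed.

Lemma C1_rV (N : nat) (f : V -> 'rV[R]_N) :
  (forall j, C1_on setT (fun x => f x ord0 j)) -> C1_on setT f.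
Proof.
move=> cf.
rewrite (_ : f = fun x => \sum_j f x ord0 j *: delta_mx ord0 j); last first.
  by apply/funext => x; exact: row_sum_delta.
apply: C1_sum => j; have dfj x := C1_differentiable x (cf j).
apply: (@C1I _ _ (fun x v => 'd (fun y => f y ord0 j) x v *: delta_mx ord0 j))
    => [x|x v|v x].
- exact: differentiableZl.
- by rewrite diffZl.
- apply: (@continuousZr_tmp _ _ _ (fun x => 'd (fun y => f y ord0 j) x v)).
  exact: C1_diff_continuous.
Qed.

Lemma C1_id : C1_on setT (@id V).
Proof.
apply: (@C1I _ _ (fun _ v => v)) => [x|x v|v x].
- exact: ex_diff.
- by rewrite diff_val.
- exact: cst_continuous.
Qed.

End C1.

Lemma diff_coord (R : realType) (V : normedModType R) (N : nat)
    (f : V -> 'rV[R]_N) (j : 'I_N) (x : V) :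
  differentiable f x ->
  differentiable (fun y => f y ord0 j) x /\
  forall v, 'd (fun y => f y ord0 j) x v = ('d f x v) ord0 j.
Proof.
(* The coordinate is packaged as a linear map, so that the chain rule for linear maps applies. *)
pose c (u : 'rV[R]_N) : R := u ord0 j.
have c_lin : linear c by move=> a u v; rewrite /c !mxE.
pose cM := GRing.isLinear.Build _ _ _ _ _ c_lin.
pose cL : {linear 'rV[R]_N -> R} := HB.pack c cM.
exact: (@diff_linear_comp _ _ _ _ cL f x (@coord_continuous _ _ _ _ _)).
Qed.

Lemma C1_coord (R : realType) (V : normedModType R) (N : nat)
    (f : V -> 'rV[R]_N) (j : 'I_N) :
  C1_on setT f -> C1_on setT (fun x => f x ord0 j).
Proof.
move=> cf; have df x := diff_coord j (C1_differentiable x cf).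
apply: (@C1I _ _ _ _ (fun x v => ('d f x v) ord0 j)) => [x|x v|v x].
- by case: (df x).
- by case: (df x).
- apply: (@continuous_comp _ _ _ (fun y => 'd f y v)
    (fun u : 'rV[R]_N => u ord0 j)); last exact: coord_continuous.
  exact: C1_diff_continuous.
Qed.

(** * Squared Euclidean norm and stereographic parametrization of the sphere *)

Definition sqnorm (R : realType) (n : nat) (x : 'rV[R]_n) : R :=
  \sum_i x ord0 i ^+ 2.

Lemma sqnorm_ge0 (R : realType) (n : nat) (x : 'rV[R]_n) : 0 <= sqnorm x.
Proof. by apply: sumr_ge0 => i _; exact: sqr_ge0. Qed.

Lemma sqnorm_eq0 (R : realType) (n : nat) (x : 'rV[R]_n) :
  sqnorm x = 0 -> x = 0.
Proof.
move=> /eqP; rewrite psumr_eq0 => [/allP x0|i _]; last exact: sqr_ge0.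
apply/rowP => i; rewrite mxE; apply/eqP; rewrite -sqrf_eq0.
exact: x0 (mem_index_enum i).
Qed.

Lemma sqnormZ (R : realType) (n : nat) (a : R) (x : 'rV[R]_n) :
  sqnorm (a *: x) = a ^+ 2 * sqnorm x.
Proof. by rewrite mulr_sumr; apply: eq_bigr => i _; rewrite mxE exprMn. Qed.

Section Stereographic.
Variables (R : realType) (n : nat).

Definition stereo_scale (y : 'rV[R]_n) : R := 2 * (1 + sqnorm y)^-1.

(** Inverse stereographic projection from the pole $(-1, 0, \dots, 0)$: $y \mapsto (1 - |y|^2, 2y) /
    (1 + |y|^2)$. *)
Definition stereo (y : 'rV[R]_n) : 'rV[R]_n.+1 :=
  \row_k (if unlift ord0 k is Some j then stereo_scale y * y ord0 j
          else stereo_scale y - 1).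

Lemma stereo0 y : stereo y ord0 ord0 = stereo_scale y - 1.
Proof. by rewrite mxE unlift_none. Qed.

Lemma stereo_lift y j :
  stereo y ord0 (lift ord0 j) = stereo_scale y * y ord0 j.
Proof. by rewrite mxE liftK. Qed.

Lemma sqnormD1_gt0 (y : 'rV[R]_n) : 0 < 1 + sqnorm y.
Proof. by rewrite ltr_pwDl // sqnorm_ge0. Qed.

Lemma stereo_scale_neq0 y : stereo_scale y != 0.
Proof. by rewrite mulf_neq0 ?invr_eq0 ?pnatr_eq0 // gt_eqF // sqnormD1_gt0. Qed.

Lemma stereo_sphere y : unit_sphere (stereo y).
Proof.
rewrite /unit_sphere /= big_ord_recl stereo0.
under eq_bigr do rewrite stereo_lift exprMn.
rewrite -mulr_sumr -/(sqnorm y).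
have : stereo_scale y * (1 + sqnorm y) = 2.
  by rewrite /stereo_scale mulfVK // gt_eqF // sqnormD1_gt0.
set r := stereo_scale y; set s := sqnorm y => rs.
(* With $r(1+s) = 2$ the right-hand side becomes $2r - 2r + 1 = 1$. *)
have -> : (r - 1) ^+ 2 + r ^+ 2 * s = r * (r * (1 + s)) - 2 * r + 1 by ring.
by rewrite rs; ring.
Qed.

(** At the pole, where the first coordinate is $-1$, the convention $0^{-1} = 0$ gives the value
    0. *)
Definition stereo_inv (x : 'rV[R]_n.+1) : 'rV[R]_n :=
  (1 + x ord0 ord0)^-1 *: \row_j x ord0 (lift ord0 j).

Lemma stereoK y : stereo_inv (stereo y) = y.
Proof.
apply/rowP => j; rewrite !mxE unlift_none liftK.
by rewrite subrKC mulKf ?stereo_scale_neq0.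
Qed.

Lemma stereo_invK x :
  unit_sphere x -> 1 + x ord0 ord0 != 0 -> stereo (stereo_inv x) = x.
Proof.
rewrite /unit_sphere /= big_ord_recl => xS x0.
(* On the sphere the last $n$ coordinates have square sum $1 - x_0^2$, so $|y|^2 = (1 - x_0)/(1 +
   x_0)$ for the projected point $y$, and $2/(1 + |y|^2) = 1 + x_0$. *)
have r_x : stereo_scale (stereo_inv x) = 1 + x ord0 ord0.
  rewrite /stereo_scale sqnormZ [sqnorm _](_ : _ = 1 - x ord0 ord0 ^+ 2).
    field; rewrite x0 /= (_ : _ + _ = 2 * (1 + x ord0 ord0)); last by ring.
    by rewrite mulf_neq0.
  apply/(addrI (x ord0 ord0 ^+ 2)); rewrite subrKC -xS.
  by congr (_ + _); apply: eq_bigr => i _; rewrite mxE.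
apply/rowP => k; case: (unliftP ord0 k) => [j|] ->.
  by rewrite stereo_lift r_x !mxE mulVKf.
by rewrite stereo0 r_x addrC addKr.
Qed.

Lemma C1_sqnorm : C1_on setT (@sqnorm R n).
Proof.
apply: C1_sum => i; under eq_fun do rewrite expr2.
by apply: C1M; exact/C1_coord/C1_id.
Qed.

Lemma C1_stereo_scale : C1_on setT stereo_scale.
Proof.
apply: C1M; first exact: C1_cst.
apply: C1V => [y|]; first by rewrite gt_eqF // sqnormD1_gt0.
by apply: C1D; [exact: C1_cst|exact: C1_sqnorm].
Qed.

Lemma C1_stereo : C1_on setT stereo.
Proof.
apply: C1_rV => k; case: (unliftP ord0 k) => [j|] ->.
  under eq_fun do rewrite stereo_lift.
  by apply: C1M; [exact: C1_stereo_scale|exact/C1_coord/C1_id].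
under eq_fun do rewrite stereo0.
by apply: C1D; [exact: C1_stereo_scale|exact: C1_cst].
Qed.

(* Differentiate [stereo_j = (1 + stereo_0) y_j] in a direction killed by
   ['d stereo]. *)
Lemma diff_stereo_eq0 (y v : 'rV[R]_n) : 'd stereo y v = 0 -> v = 0.
Proof.
move=> dv; apply/rowP => j; rewrite mxE.
have ds := C1_differentiable y C1_stereo.
have dr := C1_differentiable y C1_stereo_scale.
have dy : differentiable (fun y : 'rV[R]_n => y ord0 j : R) y.
  exact: differentiable_coord.
have rE : stereo_scale = fun y => stereo y ord0 ord0 + 1.
  by apply/funext => z; rewrite stereo0 subrK.
have r0 : 'd stereo_scale y v = 0.
  rewrite rE (@diffD _ _ _ (fun y => stereo y ord0 ord0) (cst 1)).
  - rewrite /= diff_cst /= addr0.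
    by have [_ ->] := diff_coord ord0 ds; rewrite dv mxE.
  - by case: (diff_coord ord0 ds).
  - exact: differentiable_cst.
have [_ /(_ v)] := diff_coord (lift ord0 j) ds.
rewrite dv mxE; under eq_fun do rewrite stereo_lift.
(* Since the scale has zero derivative along [v], the product rule leaves the scale times $v_j$. *)
rewrite (diffM dr dy) fctE /= r0 [_ *: 0]mulr0 addr0 => /eqP.
rewrite mulf_eq0 (negbTE (stereo_scale_neq0 y)) /= => /eqP <-.
have [_ ->] := diff_coord j (C1_differentiable y (@C1_id _ 'rV[R]_n)).
by rewrite diff_val.
Qed.

End Stereographic.

(** * The quadratic graph over the sphere as an embedding and a submanifold *)

Lemma C1_row_mx (R : realType) (V : normedModType R) (k l : nat)
    (f : V -> 'rV[R]_k) (g : V -> 'rV[R]_l) :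
  C1_on setT f -> C1_on setT g -> C1_on setT (fun x => row_mx (f x) (g x)).
Proof.
move=> cf cg; apply: C1_rV => j; case: (split_ordP j) => i ->.
  by under eq_fun do rewrite row_mxEl; exact: C1_coord.
by under eq_fun do rewrite row_mxEr; exact: C1_coord.
Qed.

(** The value of the differential at [v] is a directional derivative, which depends only on the germ
    of the map. *)
Lemma near_eq_diff (R : realType) (V W : normedModType R) (f g : V -> W)
    (x v : V) :
  differentiable f x -> differentiable g x -> (\near x, f x = g x) ->
  'd f x v = 'd g x v.
Proof. by move=> df dg fg; rewrite -!deriveE //; exact: near_eq_derive. Qed.

Section QuadraticGraph.
Variables (R : realType) (n m : nat).
Variable B : {bilinear 'rV[R]_n.+1 -> 'rV[R]_n.+1 -> 'rV[R]_m}.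

Definition quadratic_graph (x : 'rV[R]_n.+1) : 'rV[R]_(n.+1 + m) :=
  row_mx x (B x x).

Local Notation F := quadratic_graph.
Local Notation S := (@unit_sphere R n).

Lemma lsubmx_graph (x : 'rV[R]_n.+1) : lsubmx (F x) = x.
Proof. exact: row_mxKl. Qed.

Lemma C1_quadratic_graph : C1_on setT F.
Proof.
apply: C1_row_mx; first exact: C1_id.
apply: (@C1_bilinear_comp _ _ _ _ _ B id id); try exact: C1_id.
exact: bilinear_rV_continuous.
Qed.

(** Differentiating [lsubmx (F x) = x] shows that [lsubmx] is a left inverse of ['d F x]. *)
Lemma diff_quadratic_graph_eq0 (x v : 'rV[R]_n.+1) : 'd F x v = 0 -> v = 0.
Proof.
move=> dv; have dF := C1_differentiable x C1_quadratic_graph.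
have [_ /(_ v)] := diff_linear_comp (L := lsubmx)
  (@linear_mx_continuous _ _ _ _ _) dF.
rewrite dv linear0; under eq_fun do rewrite /= lsubmx_graph.
by rewrite diff_val.
Qed.

Lemma quadratic_graph_embedding : C1_embedding S F.
Proof.
split.
- move=> p _; exists setT, F; split=> //; first exact: C1_quadratic_graph.
  by move=> v _; exact: diff_quadratic_graph_eq0.
- exact/continuous_subspaceT/C1_continuous/C1_quadratic_graph.
- exists lsubmx; split; first by move=> x _; rewrite lsubmx_graph.
  exact/continuous_subspaceT/continuous_lsubmx.
Qed.

(** The sign is 1 unless $x_0 = -1$; then $e = -1$ gives $1 + e x_0 = 2$. *)
Lemma sphere_hemisphere (x : 'rV[R]_n.+1) :
  exists2 e : R, e * e = 1 & 1 + e * x ord0 ord0 != 0.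
Proof.
have [x0|x0] := eqVneq (1 + x ord0 ord0) 0; last by exists 1; rewrite !mul1r.
exists (-1); first by rewrite mulrNN mulr1.
rewrite mulN1r (_ : x _ _ = -1) ?opprK ?pnatr_eq0 //.
by apply/eqP; rewrite -addr_eq0 addrC x0.
Qed.

Lemma unit_sphereZ (e : R) (x : 'rV[R]_n.+1) : e * e = 1 -> S x -> S (e *: x).
Proof.
move=> ee xS; rewrite /unit_sphere /=.
by have := sqnormZ e x; rewrite expr2 ee mul1r {2}/sqnorm xS.
Qed.

(* The charts are the inverse stereographic projections from the two poles
   on the first coordinate axis; the sign [e] selects one that avoids [x]. *)
Lemma quadratic_graph_submanifold : C1_submanifold n (F @` S).
Proof.
move=> _ [x xS <-]; have [e ee x0] := sphere_hemisphere x.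
(* The denominator of [stereo_inv] at [e *: lsubmx z]; the chart is valid where it does not
   vanish. *)
pose h (z : 'rV[R]_(n.+1 + m)) : R := 1 + e * lsubmx z ord0 ord0.
have ch : continuous h.
  apply: C1_continuous; apply: C1D; first exact: C1_cst.
  apply: C1M; [exact: C1_cst|apply: C1_coord].
  apply: (@C1_linear_comp _ _ _ _ lsubmx); last exact: C1_id.
  exact: linear_mx_continuous.
have hE z : h z = 1 + (e *: lsubmx z) ord0 ord0 by rewrite mxE.
pose phi (y : 'rV[R]_n) := F (e *: stereo y).
have es_C1 : C1_on setT (fun y : 'rV[R]_n => e *: stereo y).
  apply: (@C1_linear_comp _ _ _ _ ( *:%R e)); last exact: C1_stereo.
  exact: linear_mx_continuous.
have phi_C1 : C1_on setT phi.
  apply: C1_row_mx => //; apply: C1_bilinear_comp => //.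
  exact: bilinear_rV_continuous.
have escK (z : 'rV[R]_n.+1) : e *: (e *: z) = z by rewrite scalerA ee scale1r.
exists [set z | h z != 0], setT, phi,
  (fun z => (h z)^-1 *: \row_j (e *: lsubmx z) ord0 (lift ord0 j));
  split=> //.
- split; last by rewrite /= hE lsubmx_graph mxE.
  by apply: (@open_comp _ _ h [set r | r != 0]) => [z _|];
    [exact: ch|exact: open_neq].
(* The differential of [phi] is that of [F] after [e] times that of [stereo]; each has trivial
   kernel. *)
- move=> y _ v w vw; apply/subr0_eq/(@diff_stereo_eq0 _ _ y).
  have ds := C1_differentiable y (@C1_stereo R n).
  have des := C1_differentiable y es_C1.
  have dL u : 'd (fun y : 'rV[R]_n => e *: stereo y) y u =
      e *: 'd (@stereo R n) y u.
    exact: (diff_linear_comp (L := *:%R e)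
      (@linear_mx_continuous _ _ _ _ _) ds).2 u.
  have dF := C1_differentiable (e *: stereo y) C1_quadratic_graph.
  have : 'd phi y (v - w) = 0 by rewrite linearB vw subrr.
  rewrite (diff_comp des dF) /= => /diff_quadratic_graph_eq0.
  move=> /(etrans (esym (dL _))) dv.
  by rewrite -[LHS]escK dv scaler0.
(* The image of [phi] is the graph over the sphere minus the single pole where [h] vanishes. *)
- apply/seteqP; split=> [_ [y _ <-]|_ [[y yS <-] /= hy]].
    split.
      by exists (e *: stereo y) => //; exact/unit_sphereZ/stereo_sphere.
    by rewrite /= hE lsubmx_graph escK stereo0 subrKC stereo_scale_neq0.
  exists (stereo_inv (e *: y)) => //.
  rewrite /phi stereo_invK ?escK //; first exact: unit_sphereZ.
  by move: hy; rewrite hE lsubmx_graph.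
- split=> [y _|]; first by rewrite hE lsubmx_graph escK; exact: stereoK.
  apply: continuous_in_subspaceT => z; rewrite inE => -[_ /= hz].
  have cl : {for z, continuous (fun z : 'rV[R]_(n.+1 + m) => e *: lsubmx z)}.
    apply: (@continuous_comp _ _ _ lsubmx ( *:%R e)).
      exact: continuous_lsubmx.
    exact: linear_mx_continuous.
  (* Dropping the first coordinate is linear, so [psi] is the product of $h^{-1}$ with a continuous
     map. *)
  pose tl (x : 'rV[R]_n.+1) : 'rV[R]_n := \row_j x ord0 (lift ord0 j).
  have tl_lin : linear tl by move=> a u v; apply/rowP => j; rewrite !mxE.
  pose tlM := GRing.isLinear.Build _ _ _ _ _ tl_lin.
  pose tlL : {linear 'rV[R]_n.+1 -> 'rV[R]_n} := HB.pack tl tlM.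
  apply: (@continuousZ _ _ _ (fun z => (h z)^-1)
    (fun z => tl (e *: lsubmx z))); last first.
    apply: (@continuous_comp _ _ _
      (fun z : 'rV[R]_(n.+1 + m) => e *: lsubmx z) tl) => //.
    exact: (@linear_mx_continuous _ _ _ _ tlL).
  by apply: continuousV => //; exact: ch.
Qed.

End QuadraticGraph.

(** * Inner product, and directions of affine lines *)

Definition dot (R : realType) (n : nat) (x y : 'rV[R]_n) : R :=
  \sum_i x ord0 i * y ord0 i.

Lemma dotC (R : realType) (n : nat) (x y : 'rV[R]_n) : dot x y = dot y x.
Proof. by apply: eq_bigr => i _; rewrite mulrC. Qed.

Lemma dotPr (R : realType) (n : nat) (a : R) (x y z : 'rV[R]_n) :
  dot x (a *: y + z) = a * dot x y + dot x z.
Proof.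
rewrite /dot mulr_sumr -big_split; apply: eq_bigr => i _ /=.
by rewrite !mxE; ring.
Qed.

Lemma sqnormDZ (R : realType) (n : nat) (a : R) (x u : 'rV[R]_n) :
  sqnorm (x + a *: u) = sqnorm x + 2 * a * dot x u + a ^+ 2 * sqnorm u.
Proof.
rewrite /sqnorm /dot !mulr_sumr -!big_split; apply: eq_bigr => i _ /=.
by rewrite !mxE; ring.
Qed.

(** Leibniz rule for [dot (f y) (f y)]: its two terms agree by symmetry. *)
Lemma diff_sqnorm_comp (R : realType) (V : normedModType R) (n : nat)
    (f : V -> 'rV[R]_n) (x v : V) :
  differentiable f x ->
  differentiable (fun y => sqnorm (f y)) x /\
  'd (fun y => sqnorm (f y)) x v = 2 * dot (f x) ('d f x v).
Proof.
move=> df.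
have dot_lin : bilinear_for
    (GRing.Scale.Law.clone _ _ *:%R _) (GRing.Scale.Law.clone _ _ *:%R _)
    (@dot R n).
  split=> z a u w; last exact: dotPr.
  by rewrite /= ![dot _ z]dotC; exact: dotPr.
pose dotM := bilinear_isBilinear.Build R _ _ _ _ _ _ dot_lin.
pose dotB : {bilinear 'rV[R]_n -> 'rV[R]_n -> R} := HB.pack (@dot R n) dotM.
have -> : (fun y => sqnorm (f y)) = fun y => dotB (f y) (f y).
  by apply/funext => y; apply: eq_bigr => i _; rewrite expr2.
have [dff ->] := diff_bilinear_comp
  (bilinear_rV_continuous (B := dotB)) df df.
split=> //; rewrite mulrDl !mul1r; congr (_ + _).
exact: dotC.
Qed.

(** The points [p] and [p + v] have parameters [s] and [t] on the second line, so $v = (t - s)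
    w$. *)
Lemma affine_line_eq (R : realType) (N : nat) (p q v w : 'rV[R]_N) :
  affine_line p v = affine_line q w -> exists a, v = a *: w.
Proof.
move=> E.
have [s _ ps] : affine_line q w p.
  by rewrite -E; exists 0; rewrite // scale0r addr0.
have [t _ pt] : affine_line q w (p + v).
  by rewrite -E; exists 1; rewrite // scale1r.
exists (t - s); apply: (addrI p); rewrite -pt -ps scalerBl.
by rewrite -addrA subrKC.
Qed.

(** * Tangent vectors of the graph and skewness of its tangent lines *)

Section Skewness.
Variables (R : realType) (n m : nat).
Variable B : {bilinear 'rV[R]_n.+1 -> 'rV[R]_n.+1 -> 'rV[R]_m}.
Hypothesis Bsym : symmetric_bilinear B.

Local Notation F := (quadratic_graph B).
Local Notation S := (@unit_sphere R n).

(** A curve in the graph splits as $(a, b)$ with $|a|^2 = 1$ and $b = B(a, a)$; both identities are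
    differentiated at 0. *)
Lemma tangent_quadratic_graph (x : 'rV[R]_n.+1) (w : 'rV[R]_(n.+1 + m)) :
  tangent_vector (F @` S) (F x) w ->
  exists2 u, dot x u = 0 & w = row_mx u (2 *: B x u).
Proof.
move=> [e [c [e0 [_ cC1] cM c0 dcw]]].
have e0I : `]- e, e[%classic (0 : R) by rewrite /= in_itv /= oppr_lt0 e0.
have [dc _] := cC1 0 e0I.
(* The curve is known to lie in the graph only on this interval, so the identities are
   differentiated as equalities near 0. *)
have near0 : \forall t \near (0 : R), - e < t < e.
  by apply: filterS (near_in_itvoo e0I) => t; rewrite in_itv.
pose a t : 'rV[R]_n.+1 := lsubmx (c t).
have [da aE] : differentiable a 0 /\ 'd a 0 1 = lsubmx w.
  have [da daE] := diff_linear_comp (L := lsubmx)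
    (@linear_mx_continuous _ _ _ _ _) dc.
  by split; [exact: da|rewrite -dcw; exact: daE].
pose b t : 'rV[R]_m := rsubmx (c t).
have [db bE] : differentiable b 0 /\ 'd b 0 1 = rsubmx w.
  have [db dbE] := diff_linear_comp (L := rsubmx)
    (@linear_mx_continuous _ _ _ _ _) dc.
  by split; [exact: db|rewrite -dcw; exact: dbE].
have aM t : - e < t < e -> S (a t) /\ b t = B (a t) (a t).
  move=> /cM [y yS cy]; rewrite /a /b -cy lsubmx_graph; split=> //.
  exact: row_mxKr.
have a0 : a 0 = x by rewrite /a c0 lsubmx_graph.
exists (lsubmx w).
  have [dn dnE] := diff_sqnorm_comp (1 : R) da.
  have : 'd (fun t => sqnorm (a t)) 0 1 = 'd (cst (1 : R)) (0 : R) 1.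
    apply: near_eq_diff; [exact: dn|exact: differentiable_cst|].
    by near=> t; have [] := aM t; first by near: t.
  rewrite dnE diff_cst a0 aE => /eqP.
  by rewrite mulf_eq0 pnatr_eq0 /= => /eqP.
rewrite -[LHS]hsubmxK; congr row_mx.
have [dB dBE] := diff_bilinear_comp (bilinear_rV_continuous (B := B)) da da.
rewrite -bE (@near_eq_diff _ _ _ _ (fun t => B (a t) (a t))) //.
  by rewrite dBE a0 aE [B (lsubmx w) x]Bsym scaler_nat.
by near=> t; have [] := aM t; first by near: t.
Unshelve. all: by end_near. Qed.

Hypothesis Bns : nonsingular_bilinear B.

Lemma tangent_lines_skew (x y u v : 'rV[R]_n.+1) :
  S x -> S y -> x <> y -> dot x u = 0 -> u != 0 -> v != 0 ->
  Defs.skew (affine_line (F x) (row_mx u (2 *: B x u)))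
       (affine_line (F y) (row_mx v (2 *: B y v))).
Proof.
move=> xS yS xy xu u0 v0.
have two0 : (2 : R) != 0 by rewrite pnatr_eq0.
have scale2I (z z' : 'rV[R]_m) : 2 *: z = 2 *: z' -> z = z'.
  exact: (scalerI two0).
split.
  move=> [p [q [w [w0 /affine_line_eq[a uw] /affine_line_eq[b vw]]]]].
  have b0 : b != 0.
    apply: contraNneq v0 => b0; move: vw.
    by rewrite b0 scale0r -row_mx0 => /eq_row_mx[->].
  (* Eliminating the common direction [w] gives $bu = av$ and $B(x, bu) = B(y, av)$, hence $B(x - y,
     bu) = 0$. *)
  have : b *: row_mx u (2 *: B x u) = a *: row_mx v (2 *: B y v).
    by rewrite uw vw !scalerA mulrC.
  rewrite !scale_row_mx => /eq_row_mx[buav].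
  rewrite ![_ *: (2 *: _)]scalerA ![_ * 2]mulrC -!scalerA => /scale2I.
  rewrite -!linearZr_LR -buav => /eqP; rewrite -subr_eq0 -linearBl => /eqP.
  move=> /Bns[/subr0_eq//|/eqP]; rewrite scaler_eq0 (negbTE b0) (negbTE u0).
  by [].
apply/seteqP; split=> // z [[t _ <-] [s _]] /=.
rewrite !scale_row_mx !add_row_mx => /eq_row_mx[E1 E2].
have BXX : B (t *: u) (t *: u) = B (s *: v) (s *: v).
  (* Completing the square: the bracket is the second component of a point of the tangent line, so
     it agrees for both lines at a common point, as does $x' + u'$. *)
  have expand x' u' :
      B u' u' = B (x' + u') (x' + u') - (B x' x' + 2 *: B x' u').
    rewrite linearDl !linearDr [B u' x']Bsym scaler_nat mulr2n.
    by rewrite addrA -(addrA (B x' x')) [_ + B u' u']addrC addrK.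
  rewrite (expand x (t *: u)) (expand y (s *: v)) E1; congr (_ - _).
  by rewrite !linearZr_LR !scalerA [2 * t]mulrC [2 * s]mulrC -!scalerA E2.
have : B (t *: u - s *: v) (t *: u + s *: v) = 0.
  rewrite linearBl !linearDr BXX [B (s *: v) (t *: u)]Bsym.
  by rewrite [X in X - _]addrC subrr.
move=> /Bns[/subr0_eq tusv|/eqP].
  (* If $tu = sv$, the common point gives $x = y$. *)
  by apply: xy; apply: (addIr (t *: u)); rewrite -E1 tusv.
rewrite addr_eq0 => /eqP tusv.
have yE : y = x + (2 * t) *: u.
  by rewrite -scalerA scaler_nat mulr2n addrA -E1 tusv addrK.
(* By orthogonality $|y|^2 = |x|^2 + 4t^2|u|^2$; both norms are 1, so $t = 0$ or $u = 0$. *)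
move: yS; rewrite yE /unit_sphere /= -/(sqnorm _) sqnormDZ xu mulr0 addr0.
rewrite {1}/sqnorm xS => /eqP; rewrite -subr_eq0 addrC addKr mulf_eq0.
rewrite sqrf_eq0 mulf_eq0 (negbTE two0) /= => /orP[/eqP t0|/eqP/sqnorm_eq0 u00].
  by apply: xy; rewrite yE t0 mulr0 scale0r addr0.
by move: u0; rewrite u00 eqxx.
Qed.

End Skewness.

(** * Total skewness of the graph and existence of the minimal dimensions *)

Lemma quadratic_graph_totally_skew (R : realType) (n m : nat)
    (B : {bilinear 'rV[R]_n.+1 -> 'rV[R]_n.+1 -> 'rV[R]_m}) :
  symmetric_bilinear B -> nonsingular_bilinear B ->
  totally_skew_embedding n (@unit_sphere R n) (quadratic_graph B).
Proof.
move=> Bsym Bns; split; first exact: quadratic_graph_embedding.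
split; first exact: quadratic_graph_submanifold.
move=> _ _ l l' [x xS <-] [y yS <-] xy [w [+ w0 ->]] [z [+ z0 ->]].
move=> /(tangent_quadratic_graph Bsym)[u xu wE].
move=> /(tangent_quadratic_graph Bsym)[v _ zE].
rewrite wE zE; apply: tangent_lines_skew => //.
- by move=> xyE; apply: xy; rewrite xyE.
(* If [u] vanished, so would $2B(x, u)$ and the whole tangent vector. *)
- by apply: contraNneq w0 => u0; rewrite wE u0 linear0r scaler0 row_mx0.
- by apply: contraNneq z0 => v0; rewrite zE v0 linear0r scaler0 row_mx0.
Qed.

(* Multiplication of polynomials of degree at most [n]. *)
Lemma symmetric_nonsingular_exists (R : realType) (n : nat) :
  exists B : {bilinear 'rV[R]_n.+1 -> 'rV[R]_n.+1 -> 'rV[R]_(n + n.+1)},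
    symmetric_bilinear B /\ nonsingular_bilinear B.
Proof.
pose b (x y : 'rV[R]_n.+1) : 'rV[R]_(n + n.+1) :=
  poly_rV (rVpoly x * rVpoly y).
have b_lin : bilinear_for
    (GRing.Scale.Law.clone _ _ *:%R _) (GRing.Scale.Law.clone _ _ *:%R _) b.
  split=> z a u w; rewrite /b /= !linearP /=.
    by rewrite mulrDl -scalerAl linearP.
  by rewrite mulrDr -scalerAr linearP.
pose bM := bilinear_isBilinear.Build R _ _ _ _ _ _ b_lin.
pose bB : {bilinear 'rV[R]_n.+1 -> 'rV[R]_n.+1 -> 'rV[R]_(n + n.+1)} :=
  HB.pack b bM.
exists bB; split=> x y; first by rewrite /= /b mulrC.
move=> /(congr1 rVpoly); rewrite /= /b linear0 poly_rV_K.
  (* Real polynomials have no zero divisors. *)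
  move=> /eqP; rewrite mulf_eq0 => /orP[] /eqP p0; [left|right];
    by rewrite -[LHS]rVpolyK p0 linear0.
(* The product has size at most $(n+1) + (n+1) - 1$, exactly the length of the target row, so
   [poly_rV] truncates nothing. *)
apply: leq_trans (size_polyMleq _ _) _; rewrite -subn1 leq_subLR add1n -addSn.
by apply: leq_add; exact: size_poly.
Qed.

(** Well-ordering of the naturals, with [P] made boolean classically. *)
Lemma is_smallest_exists (P : nat -> Prop) :
  (exists k, P k) -> exists k, is_smallest P k.
Proof.
move=> [k Pk]; have exP : exists k, `[< P k >] by exists k; exact/asboolP.
case: (ex_minnP exP) => j /asboolP Pj jmin; exists j; split=> // i Pi.
exact/jmin/asboolP.
Qed.

Theorem theorem1p2 (R : realType) (n : nat) (hn : (1 <= n)%N) :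
  (forall (m : nat) (B : {bilinear 'rV[R]_n.+1 -> 'rV[R]_n.+1 -> 'rV[R]_m}),
     symmetric_bilinear B -> nonsingular_bilinear B ->
     totally_skew_embedding n (@unit_sphere R n)
       (fun x : 'rV[R]_n.+1 => row_mx x (B x x))) /\
  (exists N_Sn m_n : nat,
     [/\ is_totally_skew_dim n (@unit_sphere R n) N_Sn,
         is_symmetric_nonsingular_dim R n m_n &
         (N_Sn <= n + m_n + 1)%N]).

Proof.
have part1 := @quadratic_graph_totally_skew R n; split=> [m B|].
  exact: part1.
have [m_n m_nE] : exists m, is_symmetric_nonsingular_dim R n m.
  apply: is_smallest_exists; exists (n + n.+1)%N.
  exact: symmetric_nonsingular_exists.
have [[B [Bsym Bns]] _] := m_nE.
(* A map [B] of minimal target dimension both shows that $N(\mathbf{S}^n)$ exists and bounds it by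
   $(n+1) + m(n)$. *)
have embB : exists f : 'rV[R]_n.+1 -> 'rV[R]_(n.+1 + m_n),
    totally_skew_embedding n (@unit_sphere R n) f.
  by exists (quadratic_graph B); exact: part1.
have [N_Sn N_SnE] : exists N, is_totally_skew_dim n (@unit_sphere R n) N.
  by apply: is_smallest_exists; exists (n.+1 + m_n)%N.
exists N_Sn, m_n; split=> //.
by rewrite addn1 -addSn; exact: N_SnE.2 embB.
Qed.
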